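(* Consider the connected three-cell networks listed in the context (with their names). For each such network $\mathcal{N}$, take a coupled cell system $f^{\mathcal{N}}$ with $f$ generic and let $J_f^{\mathcal{N}}$ be its Jacobian matrix at the origin. Then: (i) For $E_6\&E_4$, $J_f^{\mathcal{N}}$ has the valency eigenvalue with algebraic and geometric multiplicities $2$ and the eigenvalue $f_0$ with multiplicity $1$. (ii) For $C$ and $C_1\&C_2$, $J_f^{\mathcal{N}}$ has the valency eigenvalue with multiplicity $1$ and the eigenvalue $f_0$ with algebraic and geometric multiplicities $2$. (iii) For $D$, $C_1\&D_1$, $C_1\&D_4$, $C_1\&D_6$ and $D_1\&D_4$, $J_f^{\mathcal{N}}$ has the valency eigenvalue with multiplicity $1$ and the eigenvalue $f_0$ with algebraic multiplicity $2$ and geometric multiplicity $1$. (iv) For $F$, all networks in Lists III and V, and $E_6\&B_1$, $B_1\&F_2$, $B_1\&B_3$, $J_f^{\mathcal{N}}$ has three distinct real eigenvalues with multiplicity $1$. (v) For all networks in List II and the network $\mathcal{M}_6$, $J_f^{\mathcal{N}}$ has three distinct real eigenvalues with multiplicity $1$ on an open set of the generic functions. (vi) For $A$, $C_1\&A_2$ and $A_2\&A_1$, $J_f^{\mathcal{N}}$ has three distinct eigenvalues with multiplicity $1$, where the two eigenvalues different from the valency have nonzero imaginary parts.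
   Context: **Networks.** A three-cell network with $k$ asymmetric inputs has cells $1,2,3$ and edges of $k$ types, each cell receiving exactly one edge of each type. An edge type is described by $[a\,b\,c]$, meaning that the edges of that type ending at cells $1,2,3$ start at cells $a,b,c$ respectively; its adjacency matrix $A_l$ has $(A_l)_{ij}=1$ if the type-$l$ edge ending at $i$ starts at $j$, and $0$ otherwise. Edge types: $A_1=[3\,1\,2]$, $A_2=[2\,3\,1]$; $B_1=[1\,3\,2]$, $B_2=[3\,2\,1]$, $B_3=[2\,1\,3]$; $C_1=[1\,1\,1]$, $C_2=[2\,2\,2]$; $D_1=[1\,1\,2]$, $D_2=[1\,3\,1]$, $D_4=[2\,2\,1]$, $D_5=[3\,1\,3]$, $D_6=[2\,3\,3]$; $E_1=[1\,2\,1]$, $E_3=[1\,2\,2]$, $E_4=[1\,3\,3]$, $E_6=[1\,1\,3]$; $F_1=[2\,1\,1]$, $F_2=[2\,1\,2]$, $F_3=[2\,3\,2]$, $F_4=[3\,3\,2]$, $F_5=[3\,3\,1]$, $F_6=[3\,1\,1]$. (In this list the letters name edge types.) $X\&Y$ denotes the network with two asymmetric inputs whose first and second edge types are $X$ and $Y$. One-input networks: $A=[3\,1\,2]$, $C=[1\,1\,1]$, $D=[1\,1\,2]$, $F=[2\,1\,1]$. List I: $E_6\&B_1$, $B_1\&F_2$, $C_1\&A_2$, $A_2\&A_1$, $B_1\&B_3$. List II: $D_1\&F_3$, $D_1\&D_6$, $D_1\&F_6$, $D_1\&A_1$, $D_1\&D_2$, $D_1\&D_5$, $D_1\&B_1$,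 $D_1\&B_2$, $D_1\&E_4$, $E_6\&A_2$, $B_1\&A_2$, $F_1\&A_2$, $D_1\&A_2$, $F_1\&A_1$. List III: $D_1\&E_1$, $D_1\&F_1$, $D_1\&F_2$, $D_1\&B_3$, $C_1\&B_1$, $D_1\&F_4$, $C_1\&B_3$, $E_6\&F_3$, $D_1\&E_6$, $E_6\&F_6$, $E_6\&F_4$, $B_1\&F_1$, $F_1\&F_2$, $F_1\&F_3$, $F_1\&F_6$, $D_1\&F_5$. List IV: $E_6\&E_4$, $C_1\&D_1$, $C_1\&D_4$, $C_1\&D_6$, $D_1\&D_4$. List V: $C_1\&E_6$, $C_1\&E_3$, $C_1\&F_1$, $C_1\&F_2$, $C_1\&F_3$, $E_6\&F_5$, $F_1\&F_4$. List VI: $C_1\&C_2$. Six-input network $\mathcal{M}_6$: edge types $[1\,1\,1]$, $[2\,2\,2]$, $[3\,3\,3]$, $[1\,1\,2]$, $[3\,2\,2]$, $[3\,1\,3]$. **Jacobian.** A smooth $f:\mathbb{R}\times\mathbb{R}^k\times\mathbb{R}\to\mathbb{R}$ (last variable a parameter $\lambda$) defines $f^{\mathcal{N}}_i(x,\lambda)=f(x_i,x_{i_1},\dots,x_{i_k},\lambda)$, $i_j$ the source of the type-$j$ edge ending at $i$. With $f_j$ the derivative of $f$ at the origin with respect to its $(j+1)$-th variable, $J_f^{\mathcal{N}}=f_0\mathrm{Id}_3+\sum_{j=1}^kf_jA_j$ ($A_j$ here the adjacency matrix of the $j$-th edge type of $\mathcal{N}$). The valency eigenvalue is $\sum_{j=0}^kf_j$.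 Generic $f$: $f$ satisfies a suitable finite number of non-trivial inequalities ($\neq$) on its derivatives at the origin. ''On an open set of the generic functions'' means for generic $f$ with $(f_0,\dots,f_k)$ in some nonempty open subset of $\mathbb{R}^{k+1}$. *)

(* Defs.v *)
From HB Require Import structures.
From mathcomp Require Import all_boot all_order all_algebra.
From mathcomp Require Export complex.
From mathcomp Require Import all_classical all_reals all_analysis.
(* The notations of mpoly clash with those of mathcomp-analysis: below,
   [mpoly n R] is the ring of polynomials in n variables over R and
   [multinom n] the type of multi-indices in n variables. *)
From mathcomp Require Import -(notations) mpoly.

Set Implicit Arguments.
Unset Strict Implicit.
Unset Printing Implicit Defensive.

Import Order.TTheory GRing.Theory Num.Theory numFieldNormedType.Exports.
Local Open Scope classical_set_scope.
Local Open Scope ring_scope.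

(** * Three-cell networks with k asymmetric inputs *)

(* [tuple a; b; c] is the edge type [a b c]: its edges ending at cells 1, 2, 3
   start at cells a, b, c. *)
Notation edge_type := (3.-tuple 'I_3).

Definition network (k : nat) : Type := k.-tuple edge_type.

Definition source (k : nat) (N : network k) (i : 'I_3) (j : 'I_k) : 'I_3 :=
  tnth (tnth N j) i.

Definition c1 : 'I_3 := @Ordinal 3 0 isT.
Definition c2 : 'I_3 := @Ordinal 3 1 isT.
Definition c3 : 'I_3 := @Ordinal 3 2 isT.

Definition A1 : edge_type := [tuple c3; c1; c2].
Definition A2 : edge_type := [tuple c2; c3; c1].
Definition B1 : edge_type := [tuple c1; c3; c2].
Definition B2 : edge_type := [tuple c3; c2; c1].
Definition B3 : edge_type := [tuple c2; c1; c3].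
Definition C1 : edge_type := [tuple c1; c1; c1].
Definition C2 : edge_type := [tuple c2; c2; c2].
Definition D1 : edge_type := [tuple c1; c1; c2].
Definition D2 : edge_type := [tuple c1; c3; c1].
Definition D4 : edge_type := [tuple c2; c2; c1].
Definition D5 : edge_type := [tuple c3; c1; c3].
Definition D6 : edge_type := [tuple c2; c3; c3].
Definition E1 : edge_type := [tuple c1; c2; c1].
Definition E3 : edge_type := [tuple c1; c2; c2].
Definition E4 : edge_type := [tuple c1; c3; c3].
Definition E6 : edge_type := [tuple c1; c1; c3].
Definition F1 : edge_type := [tuple c2; c1; c1].
Definition F2 : edge_type := [tuple c2; c1; c2].
Definition F3 : edge_type := [tuple c2; c3; c2].
Definition F4 : edge_type := [tuple c3; c3; c2].
Definition F5 : edge_type := [tuple c3; c3; c1].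
Definition F6 : edge_type := [tuple c3; c1; c1].

Definition net1 (X : edge_type) : network 1 := [tuple X].

(* X & Y *)
Definition net2 (X Y : edge_type) : network 2 := [tuple X; Y].

Definition netA : network 1 := net1 [tuple c3; c1; c2].
Definition netC : network 1 := net1 [tuple c1; c1; c1].
Definition netD : network 1 := net1 [tuple c1; c1; c2].
Definition netF : network 1 := net1 [tuple c2; c1; c1].

Definition listII : seq (network 2) :=
  [:: net2 D1 F3; net2 D1 D6; net2 D1 F6; net2 D1 A1; net2 D1 D2; net2 D1 D5;
      net2 D1 B1; net2 D1 B2; net2 D1 E4; net2 E6 A2; net2 B1 A2; net2 F1 A2;
      net2 D1 A2; net2 F1 A1].

Definition listIII : seq (network 2) :=
  [:: net2 D1 E1; net2 D1 F1; net2 D1 F2; net2 D1 B3; net2 C1 B1; net2 D1 F4;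
      net2 C1 B3; net2 E6 F3; net2 D1 E6; net2 E6 F6; net2 E6 F4; net2 B1 F1;
      net2 F1 F2; net2 F1 F3; net2 F1 F6; net2 D1 F5].

Definition listV : seq (network 2) :=
  [:: net2 C1 E6; net2 C1 E3; net2 C1 F1; net2 C1 F2; net2 C1 F3; net2 E6 F5;
      net2 F1 F4].

Definition netM6 : network 6 :=
  [tuple [tuple c1; c1; c1]; [tuple c2; c2; c2]; [tuple c3; c3; c3];
         [tuple c1; c1; c2]; [tuple c3; c2; c2]; [tuple c3; c1; c3]].

(** * Smooth functions and genericity *)

Definition partial (R : realType) (n : nat) (j : 'I_n) (g : 'rV[R]_n -> R) :
    'rV[R]_n -> R :=
  fun x => 'D_(delta_mx 0 j) g x.

Fixpoint Cdiff (R : realType) (n m : nat) (g : 'rV[R]_n -> R) : Prop :=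
  if m is m'.+1 then
    (forall x : 'rV[R]_n, differentiable g x) /\
    (forall j : 'I_n, Cdiff m' (partial j g))
  else continuous g.

Definition smooth (R : realType) (n : nat) (g : 'rV[R]_n -> R) : Prop :=
  forall m, Cdiff m g.

Definition mpartial (R : realType) (n : nat) (a : multinom n)
    (g : 'rV[R]_n -> R) : 'rV[R]_n -> R :=
  foldr (fun j h => iter (a j) (partial j) h) g (enum 'I_n).

(* A non-trivial inequality P(d_1, ..., d_N) <> 0: the d_i are the derivatives
   at the origin for distinct nonzero multi-indices and P is a nonzero
   polynomial.  Distinct multi-indices matter: iterated partial derivatives in
   two different orders agree on smooth functions, so a nonzero polynomial in
   those could vanish identically. *)
Record inequality (R : realType) (n : nat) := Inequality {
  ineq_arity : nat;
  ineq_index : ineq_arity.-tuple (multinom n);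
  ineq_poly : mpoly ineq_arity R;
  ineq_index_pos : all (fun a => 0 < mdeg a)%N ineq_index;
  ineq_index_uniq : uniq ineq_index;
  ineq_nontrivial : ineq_poly != 0 }.

Definition satisfies (R : realType) (n : nat) (g : 'rV[R]_n -> R)
    (q : inequality R n) : bool :=
  meval (fun i => mpartial (tnth (ineq_index q) i) g 0) (ineq_poly q) != 0.

(* The domain 1 + k + 1 is R x R^k x R; the last variable is the parameter. *)
Definition generically (R : realType) (k : nat)
    (P : ('rV[R]_(1 + k + 1) -> R) -> Prop) : Prop :=
  exists Q : seq (inequality R (1 + k + 1)),
    forall f, smooth f -> all (satisfies f) Q -> P f.

(* The derivative of f at the origin in its (j+1)-th variable, 0 <= j <= k. *)
Definition lcoef (R : realType) (k : nat) (f : 'rV[R]_(1 + k + 1) -> R)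
    (j : 'I_(1 + k)) : R :=
  partial (lshift 1 j) f 0.

Definition generically_on_open (R : realType) (k : nat)
    (P : ('rV[R]_(1 + k + 1) -> R) -> Prop) : Prop :=
  exists U : set 'rV[R]_(1 + k),
    [/\ open U, U !=set0 &
        generically (fun f => U (\row_j lcoef f j) -> P f)].

(** * Coupled cell systems and their Jacobian *)

Definition cell_input (R : realType) (k : nat) (N : network k)
    (x : 'rV[R]_3) (lambda : R) (i : 'I_3) : 'rV[R]_(1 + k + 1) :=
  row_mx (row_mx (x 0 i)%:M (\row_j x 0 (source N i j))) lambda%:M.

Definition coupled (R : realType) (k : nat) (N : network k)
    (f : 'rV[R]_(1 + k + 1) -> R) (x : 'rV[R]_3) (lambda : R) : 'rV[R]_3 :=
  \row_i f (cell_input N x lambda i).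

(* The library's Jacobian acts on row vectors; the transpose is the usual
   matrix whose (i, j) entry is the derivative of the i-th component in the
   j-th variable. *)
Definition jac (R : realType) (k : nat) (N : network k)
    (f : 'rV[R]_(1 + k + 1) -> R) : 'M[R]_3 :=
  (jacobian (fun x : 'rV[R]_3 => coupled N f x 0) 0)^T.

Definition valency (R : realType) (k : nat) (f : 'rV[R]_(1 + k + 1) -> R) : R :=
  \sum_(j < 1 + k) lcoef f j.

(** * Eigenvalues *)

(* [eigenspace] consists of row eigenvectors, hence the transpose. *)
Definition eigen_mult (F : fieldType) (n : nat) (J : 'M[F]_n) (a : F)
    (alg geom : nat) : Prop :=
  mup a (char_poly J) = alg /\ \rank (eigenspace J^T a) = geom.

Definition three_simple_real (R : realType) (J : 'M[R]_3) : Prop :=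
  exists a b c : R, uniq [:: a; b; c] /\
    [/\ eigen_mult J a 1 1, eigen_mult J b 1 1 & eigen_mult J c 1 1].

Definition three_simple_nonreal (R : realType) (J : 'M[R]_3) (v : R) : Prop :=
  let JC := map_mx (real_complex R) J in
  let vC := real_complex R v in
  exists z w : R[i], uniq [:: vC; z; w] /\
    [/\ eigen_mult JC vC 1 1, eigen_mult JC z 1 1, eigen_mult JC w 1 1,
        complex.Im z != 0 & complex.Im w != 0].

(* Main.v *)
(** Every row of the Jacobian J = f_0 Id + sum_l f_l A_l sums to the valency v,
    so its characteristic polynomial is (X - v)(X^2 - tX + d), where t = tr J - v
    and d = e_2(J) - v t.  Hence the spectrum is read off from two polynomials in
    f_0, ..., f_k: the discriminant t^2 - 4d and the value v^2 - tv + d, which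
    vanishes exactly when v is not simple.  For each network of (iv) the discriminant is
    a semidefinite quadratic form, so one point where neither polynomial vanishes
    gives the generic statement; for (v) one point where the discriminant is
    positive gives the open set; for (vi) the discriminant is negative
    semidefinite.  In (i)-(iii) the roots are v, v, f_0 or v, f_0, f_0, and
    only the rank of J - v Id, respectively J - f_0 Id, remains. *)

Require Import Defs.
From HB Require Import structures.
From mathcomp Require Import all_boot all_order all_algebra.
From mathcomp Require Import all_classical all_reals all_analysis.
From mathcomp Require Import -(notations) mpoly.
From mathcomp Require Import ring lra.

Set Implicit Arguments.
Unset Strict Implicit.
Unset Printing Implicit Defensive.

Import Order.TTheory GRing.Theory Num.Theory numFieldNormedType.Exports.
Local Open Scope ring_scope.

(** * Spectrum of 3 x 3 matrices with constant row sums *)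

(** The sum of the principal 2 x 2 minors, that is, the second elementary symmetric function of the
    eigenvalues. *)
Definition minors (S : comNzRingType) (M : 'M[S]_3) : S :=
  M c1 c1 * M c2 c2 - M c1 c2 * M c2 c1 +
  (M c1 c1 * M c3 c3 - M c1 c3 * M c3 c1) +
  (M c2 c2 * M c3 c3 - M c2 c3 * M c3 c2).

(* If the rows of M sum to v, this is the discriminant of the quotient of
   char_poly M by 'X - v%:P. *)
Definition disc (S : comNzRingType) (M : 'M[S]_3) (v : S) : S :=
  (\tr M - v) ^+ 2 - (minors M - v * (\tr M - v)) *+ 4.

(* The value at v of the derivative of char_poly M (see [gap_deriv]). *)
Definition gap (S : comNzRingType) (M : 'M[S]_3) (v : S) : S :=
  minors (M - v%:M).

Lemma big_cells (S : nmodType) (F : 'I_3 -> S) : \sum_i F i = F c1 + F c2 + F c3.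
Proof.
rewrite 3!big_ord_recl big_ord0 addr0 addrA.
by congr (F _ + F _ + F _); apply: val_inj.
Qed.

Lemma det_mx22 (S : comNzRingType) (M : 'M[S]_2) :
  \det M = M 0 0 * M 1 1 - M 0 1 * M 1 0.
Proof.
rewrite (expand_det_row _ 0) 2!big_ord_recl big_ord0 addr0 /cofactor !det_mx11.
have l0 : lift 0 0 = 1 :> 'I_2 by apply: val_inj.
have l1 : lift 1 0 = 0 :> 'I_2 by apply: val_inj.
by rewrite !mxE l0 l1 expr0 expr1 mul1r mulN1r mulrN.
Qed.

Lemma det_cells (S : comNzRingType) (M : 'M[S]_3) :
  \det M = M c1 c1 * (M c2 c2 * M c3 c3 - M c2 c3 * M c3 c2)
         - M c1 c2 * (M c2 c1 * M c3 c3 - M c2 c3 * M c3 c1)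
         + M c1 c3 * (M c2 c1 * M c3 c2 - M c2 c2 * M c3 c1).
Proof.
rewrite (expand_det_row _ c1) big_cells /cofactor !det_mx22 !mxE /=.
have -> : lift c1 (0 : 'I_2) = c2 by apply: val_inj.
have -> : lift c1 (1 : 'I_2) = c3 by apply: val_inj.
have -> : lift c2 (0 : 'I_2) = c1 by apply: val_inj.
have -> : lift c2 (1 : 'I_2) = c3 by apply: val_inj.
have -> : lift c3 (0 : 'I_2) = c1 by apply: val_inj.
have -> : lift c3 (1 : 'I_2) = c2 by apply: val_inj.
rewrite /= expr0 expr1 sqrrN expr1n.
by ring.
Qed.

Section CharPoly.
Variables (S : comNzRingType) (M : 'M[S]_3) (v : S).
Hypothesis rowv : forall i, M i c1 + M i c2 + M i c3 = v.

Lemma mxtrace_cells : \tr M = M c1 c1 + M c2 c2 + M c3 c3.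
Proof. exact: big_cells. Qed.

(** Constant row sums already make [v] a root, so the trace and the principal minors determine the
    other two; the determinant need not be matched. *)
Lemma char_poly_const_rows z w :
  \tr M = v + z + w -> minors M = v * z + v * w + z * w ->
  char_poly M = ('X - v%:P) * ('X - z%:P) * ('X - w%:P).
Proof.
move=> trM minM.
have M3 i : M i c3 = v - M i c1 - M i c2 by rewrite -(rowv i); ring.
have wE : w = \tr M - v - z by rewrite trM; ring.
move: minM; rewrite /char_poly det_cells /char_poly_mx !mxE /= /minors !M3.
rewrite wE mxtrace_cells !M3 => minM.
rewrite !(mulr1n, mulr0n, sub0r, polyCB, polyCD).
have := congr1 polyC minM; rewrite !(polyCB, polyCD, polyCM).
set x := v%:P; set a := (M c1 c1)%:P; set b := (M c1 c2)%:P.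
set c := (M c2 c1)%:P; set d := (M c2 c2)%:P; set e := (M c3 c1)%:P.
set g := (M c3 c2)%:P; set y := z%:P; set L := LHS; set Q := RHS => LQ.
apply/eqP; rewrite -subr_eq0; apply/eqP.
(* With the third column and [w] eliminated, the two sides differ by ['X - v%:P] times the defect
   [L - Q] of the equation on the minors. *)
by transitivity (('X - x) * (L - Q)); [rewrite /L /Q; ring | rewrite LQ; ring].
Qed.

End CharPoly.

Lemma mup_XsubC3 (F : fieldType) (x a b c : F) :
  mup x (('X - a%:P) * ('X - b%:P) * ('X - c%:P)) =
  ((a == x) + (b == x) + (c == x))%N.
Proof.
have nz y : 'X - y%:P != 0 by exact: (negbT (polyXsubC_eq0 _)).
have mupX y : mup x ('X - y%:P) = (y == x).
  by rewrite -['X - _]expr1 mup_XsubCX; case: eqP.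
by rewrite !mupM ?mulf_neq0 ?nz // !mupX.
Qed.

(** * Ranks, geometric multiplicities, simple and double roots *)

Section Rank.
Variable F : fieldType.

(** The 2 x 2 submatrix on rows [i], [j] and columns [k], [l] is [P *m A *m Q] for selection
    matrices [P], [Q]; being invertible, it bounds the rank of [A] from below. *)
Lemma rank_gt1 m n (A : 'M[F]_(m, n)) i j k l :
  A i k * A j l != A i l * A j k -> (1 < \rank A)%N.
Proof.
move=> nz; pose P := \matrix_(x < 2, y < m) ((y == if x == 0 then i else j)%:R : F).
pose Q := \matrix_(x < n, y < 2) ((x == if y == 0 then k else l)%:R : F).
have PAQ x y : (P *m A *m Q) x y =
    A (if x == 0 then i else j) (if y == 0 then k else l).
  rewrite !mxE (bigD1 (if y == 0 then k else l)) //= big1 ?addr0 => [|u /negPf ne].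
    rewrite !mxE eqxx mulr1 (bigD1 (if x == 0 then i else j)) //= big1 ?addr0.
      by rewrite mxE eqxx mul1r.
    by move=> u /negPf ne; rewrite mxE ne mul0r.
  by rewrite [Q _ _]mxE ne mulr0.
have unitB : P *m A *m Q \in unitmx.
  by rewrite unitmxE det_mx22 !PAQ /= unitfE subr_eq0.
by rewrite -(mxrank_unit unitB) (leq_trans (mxrankM_maxl _ _)) ?mxrankM_maxr.
Qed.

Lemma rank_eigenspace_tr n (M : 'M[F]_n) a :
  \rank (eigenspace M^T a) = (n - \rank (M - a%:M)%R)%N.
Proof. by rewrite mxrank_ker -[in RHS]mxrank_tr linearB /= tr_scalar_mx. Qed.

Lemma rank_cell_const n (A : 'M[F]_n.+1) i j u w :
  (forall x y, A x y = u x * w y) -> A i j != 0 -> \rank A = 1%N.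
Proof.
move=> AE nz; apply/eqP; rewrite eqn_leq lt0n mxrank_eq0; apply/andP; split.
  have -> : A = (\col_x u x) *m (\row_y w y).
    by apply/matrixP => x y; rewrite mxE big_ord1 !mxE.
  exact: mulmx_max_rank.
by apply: contraNneq nz => ->; rewrite mxE.
Qed.

End Rank.

Lemma gapE (S : comNzRingType) (M : 'M[S]_3) (v : S) :
  gap M v = minors M - v * \tr M *+ 2 + v ^+ 2 *+ 3.
Proof.
by rewrite mxtrace_cells /gap /minors !mxE /= !(mulr0n, mulr1n, subr0); ring.
Qed.

Lemma gap_deriv (S : comNzRingType) (M : 'M[S]_3) (a : S) :
  gap M a = (char_poly M)^`().[a].
Proof.
rewrite gapE mxtrace_cells /char_poly det_cells /char_poly_mx /minors !mxE /=.
rewrite !(mulr0n, mulr1n, sub0r).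
rewrite !(derivB, derivD, derivN, derivM, derivX, derivC).
rewrite !(hornerD, hornerN, hornerM, hornerX, hornerC).
by ring.
Qed.

(** [gap M a] is a sum of three 2 x 2 minors of [M - a%:M]; if all of them vanished, so would the
    sum. *)
Lemma gap_rank (F : fieldType) (M : 'M[F]_3) (a : F) :
  gap M a != 0 -> (1 < \rank (M - a%:M)%R)%N.
Proof.
rewrite /gap /minors; set A := M - a%:M => nz.
case: (eqVneq (A c1 c1 * A c2 c2) (A c1 c2 * A c2 c1)) => [e1|]; last exact: rank_gt1.
case: (eqVneq (A c1 c1 * A c3 c3) (A c1 c3 * A c3 c1)) => [e2|]; last exact: rank_gt1.
case: (eqVneq (A c2 c2 * A c3 c3) (A c2 c3 * A c3 c2)) => [e3|]; last exact: rank_gt1.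
by rewrite e1 e2 e3 !subrr !addr0 eqxx in nz.
Qed.

Section Multiplicity.
Variables (F : fieldType) (M : 'M[F]_3) (a b c : F).
Hypothesis charM : char_poly M = ('X - a%:P) * ('X - b%:P) * ('X - c%:P).

Lemma rank_sub_root : (\rank (M - a%:M)%R < 3)%N.
Proof.
have := rank_leq_row (M - a%:M); rewrite leq_eqVlt => /orP[|//].
rewrite -/(row_free _) row_free_unit unitmxE unitfE => nz.
suff d0 : \det (a%:M - M) = 0.
  by rewrite -opprB -scaleN1r detZ d0 mulr0 eqxx in nz.
(* Evaluation at [a] is a ring morphism, so it commutes with the determinant. *)
have -> : a%:M - M = map_mx (horner_eval a) (char_poly_mx M).
  apply/matrixP => i j; rewrite !mxE /horner_eval hornerD hornerN hornerC.
  by rewrite hornerMn hornerX.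
rewrite det_map_mx /= -/(char_poly M) charM /horner_eval !hornerM !hornerXsubC.
by rewrite subrr !mul0r.
Qed.

(** The root bounds the rank of [M - a%:M] by 2 from above, the gap from below. *)
Lemma geom_simple : gap M a != 0 -> \rank (eigenspace M^T a) = 1%N.
Proof.
move=> /gap_rank; have := rank_sub_root; rewrite rank_eigenspace_tr.
by case: (\rank _) => [|[|[|]]].
Qed.

End Multiplicity.

(** The derivative of a product of three linear factors, evaluated at the first root: the gap
    vanishes exactly when that root is repeated. *)
Lemma gap_roots (F : fieldType) (M : 'M[F]_3) (a b c : F) :
  char_poly M = ('X - a%:P) * ('X - b%:P) * ('X - c%:P) ->
  gap M a = (a - b) * (a - c).
Proof.
move=> charM; rewrite gap_deriv charM !(derivM, derivB, derivX, derivC).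
by rewrite !(hornerD, hornerN, hornerM, hornerX, hornerC); ring.
Qed.

Lemma simple_root (F : fieldType) (M : 'M[F]_3) (a b c : F) :
  char_poly M = ('X - a%:P) * ('X - b%:P) * ('X - c%:P) ->
  a != b -> a != c -> eigen_mult M a 1 1.
Proof.
move=> charM ab ac; split.
  by rewrite charM mup_XsubC3 eqxx !(eq_sym _ a) (negPf ab) (negPf ac).
by apply: (geom_simple charM); rewrite (gap_roots charM) mulf_neq0 ?subr_eq0.
Qed.

Lemma simple_eigenvalues (F : fieldType) (M : 'M[F]_3) (v z w : F) :
  (forall i, M i c1 + M i c2 + M i c3 = v) ->
  \tr M = v + z + w -> minors M = v * z + v * w + z * w ->
  uniq [:: v; z; w] ->
  [/\ eigen_mult M v 1 1, eigen_mult M z 1 1 & eigen_mult M w 1 1].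
Proof.
move=> rowv trM minM; rewrite /= !inE negb_or => /andP[/andP[vz vw] /andP[zw _]].
have charM := char_poly_const_rows rowv trM minM.
split; first exact: (simple_root charM).
  by apply: (@simple_root _ _ z v w) => //; [rewrite charM; ring | rewrite eq_sym].
by apply: (@simple_root _ _ w v z); rewrite 1?(eq_sym w) // charM; ring.
Qed.

Section DoubleRoot.
Variables (F : fieldType) (M : 'M[F]_3) (a b : F).
Hypothesis charM : char_poly M = ('X - a%:P) * ('X - b%:P) * ('X - b%:P).
Hypothesis ab : a != b.

Let mup2 : mup b (char_poly M) = 2%N.
Proof. by rewrite charM mup_XsubC3 eqxx (negPf ab). Qed.

Lemma semisimple_double_root :
  \rank (M - b%:M)%R = 1%N -> eigen_mult M b 2 2.
Proof. by move=> rk; split; rewrite ?rank_eigenspace_tr ?rk. Qed.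

Lemma defective_double_root :
  (1 < \rank (M - b%:M)%R)%N -> eigen_mult M b 2 1.
Proof.
have charM' : char_poly M = ('X - b%:P) * ('X - a%:P) * ('X - b%:P).
  by rewrite charM; ring.
move=> rk; split=> //; rewrite rank_eigenspace_tr; move: rk.
by have := rank_sub_root charM'; case: (\rank _) => [|[|[|]]].
Qed.

End DoubleRoot.

Lemma minors_map (S S' : comNzRingType) (h : {rmorphism S -> S'}) (M : 'M[S]_3) :
  minors (map_mx h M) = h (minors M).
Proof. by rewrite /minors !mxE !(rmorphD, rmorphN, rmorphM). Qed.

(** * Real and nonreal spectra from the sign of the discriminant *)

Section ThreeSimple.
Variables (R : realType) (M : 'M[R]_3) (v : R).
Hypothesis rowv : forall i, M i c1 + M i c2 + M i c3 = v.

(** The quadratic formula gives the two roots [z], [w] other than [v]. They differ by the square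
    root of the discriminant, and the gap [(v - z) * (v - w)] separates them from [v]. *)
Lemma three_simple_real_disc :
  0 < disc M v -> gap M v != 0 -> three_simple_real M.
Proof.
move=> d0; rewrite gapE => g0; set s := Num.sqrt (disc M v).
have s0 : 0 < s by rewrite sqrtr_gt0.
have sE : s ^+ 2 = disc M v by rewrite sqr_sqrtr // ltW.
pose z := (\tr M - v + s) / 2; pose w := (\tr M - v - s) / 2.
have minE : minors M = v * z + v * w + z * w.
  transitivity (v * (\tr M - v) + ((\tr M - v) ^+ 2 - s ^+ 2) / 4).
    by rewrite sE /disc; field.
  by rewrite /z /w; field.
have trE : \tr M = v + z + w by rewrite /z /w; field.
have gvzw : (v - z) * (v - w) != 0.
  by apply: contraNneq g0 => vzw; rewrite -vzw trE minE; apply/eqP; ring.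
exists v, z, w.
suff u : uniq [:: v; z; w] by split => //; exact: simple_eigenvalues.
move: gvzw; rewrite mulf_eq0 !subr_eq0 negb_or /= !inE negb_or => -> /=.
rewrite andbT -subr_eq0 (_ : z - w = s) ?gt_eqF //.
by rewrite /z /w; field.
Qed.

(** The two other roots are complex conjugates with nonzero imaginary part, hence distinct from each
    other and from the real [v]. *)
Lemma three_simple_nonreal_disc :
  disc M v < 0 -> three_simple_nonreal M v.
Proof.
move=> d0; set s := Num.sqrt (- disc M v).
have s0 : 0 < s by rewrite sqrtr_gt0 oppr_gt0.
have sE : s ^+ 2 = - disc M v by rewrite sqr_sqrtr // oppr_ge0 ltW.
pose z : R[i] := Complex ((\tr M - v) / 2) (s / 2).
pose w : R[i] := Complex ((\tr M - v) / 2) (- (s / 2)).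
have s2 : s / 2 != 0 by rewrite gt_eqF // divr_gt0 // ltr0n.
exists z, w.
have u : uniq [:: real_complex R v; z; w].
  rewrite /= !inE !eq_complex /= !negb_or !negb_and (eq_sym 0) s2 /=.
  rewrite (eq_sym 0) oppr_eq0 s2 !orbT /=.
  by rewrite eqxx andbT -subr_eq0 opprK -splitr gt_eqF.
have zw : z + w = real_complex R (\tr M - v).
  by rewrite /z /w; simpc; rewrite -splitr.
have zMw : z * w = real_complex R (((\tr M - v) ^+ 2 + s ^+ 2) / 4).
  by rewrite /z /w; simpc; congr Complex; field.
split; first by [].
have [] := @simple_eigenvalues _ (map_mx (real_complex R) M) (real_complex R v) z w.
- by move=> i; rewrite !mxE -!rmorphD rowv.
- by rewrite trace_map_mx -addrA zw -rmorphD addrC subrK.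
- rewrite minors_map -mulrDr zw zMw -rmorphM -rmorphD sE /disc; congr (real_complex R _).
  by field.
- by [].
move=> eV eZ eW; split; [exact eV | exact eZ | exact eW | exact s2 |].
by rewrite [complex.Im w]/= oppr_eq0.
Qed.

End ThreeSimple.

(** * The Jacobian of a network *)

(** The Jacobian with free coefficients in an arbitrary ring, so that it can be taken both at real
    numbers and at polynomial indeterminates. *)
Definition netmx (S : comNzRingType) (k : nat) (N : network k)
    (c : 'I_(1 + k) -> S) : 'M[S]_3 :=
  \matrix_(i, j) (c (lshift k ord0) *+ (i == j) +
                  \sum_(l < k) c (rshift 1 l) *+ (source N i l == j)).

Section Jacobian.
Variable R : realType.

Lemma differentiable_rV (V : normedModType R) n (g : V -> 'rV[R]_n) x :
  (forall j, differentiable (fun y => g y 0 j : R) x) -> differentiable g x.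
Proof.
move=> dg; have -> : g = \sum_j (fun y => g y 0 j *: delta_mx 0 j).
  by apply/funext => y; rewrite fct_sumE -row_sum_delta.
by apply: differentiable_sum => j; exact: differentiableZl.
Qed.

Variables (k : nat) (N : network k) (f : 'rV[R]_(1 + k + 1) -> R).

(** At parameter 0 the input of a cell is linear in [x]; this expansion in basis vectors yields its
    homogeneity, its differentiability and the entries of the Jacobian. *)
Lemma cell_input_coords (x : 'rV[R]_3) i :
  cell_input N x 0 i =
  x 0 i *: delta_mx 0 (lshift 1 (lshift k ord0)) +
  \sum_(l < k) x 0 (source N i l) *: delta_mx 0 (lshift 1 (rshift 1 l)).
Proof.
apply/rowP => j; rewrite [LHS]mxE mxE summxE.
(* Three kinds of coordinates, in this order: the parameter, the cell itself, its inputs. *)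
case: split_ordP => {}j ->; last first.
  rewrite !mxE eq_rlshift andbF mulr0 add0r mul0rn big1 // => l _.
  by rewrite !mxE eq_rlshift andbF mulr0.
rewrite [LHS]mxE; case: split_ordP => {}j ->.
  rewrite !ord1 !mxE !eqxx mulr1 big1 ?addr0 // => l _.
  by rewrite !mxE (inj_eq (@lshift_inj _ _)) eq_lrshift andbF mulr0.
rewrite !mxE (inj_eq (@lshift_inj _ _)) eq_rlshift andbF mulr0 add0r.
rewrite (bigD1 j) //= !mxE !eqxx mulr1 big1 ?addr0 // => l lj.
rewrite !mxE (inj_eq (@lshift_inj _ _)) (inj_eq (@rshift_inj _ _)) eq_sym.
by rewrite (negPf lj) andbF mulr0.
Qed.

Lemma cell_inputZ h (x : 'rV[R]_3) i :
  cell_input N (h *: x) 0 i = h *: cell_input N x 0 i.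
Proof.
rewrite !cell_input_coords scalerDr scaler_sumr !mxE scalerA.
by congr (_ + _); apply: eq_bigr => l _; rewrite mxE scalerA.
Qed.

Lemma differentiable_cell_input (x : 'rV[R]_3) i :
  differentiable (fun y : 'rV[R]_3 => cell_input N y 0 i) x.
Proof.
have -> : (fun y : 'rV[R]_3 => cell_input N y 0 i) =
    (fun y : 'rV[R]_3 => y 0 i *: delta_mx 0 (lshift 1 (lshift k ord0))) +
    \sum_(l < k) (fun y : 'rV[R]_3 => y 0 (source N i l) *:
                           delta_mx 0 (lshift 1 (rshift 1 l))).
  by apply/funext => y; rewrite cell_input_coords fctE fct_sumE.
apply: differentiableD.
  by apply: differentiableZl; exact: differentiable_coord.
apply: differentiable_sum => l.
by apply: differentiableZl; exact: differentiable_coord.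
Qed.

(** Chain rule: entry (i, j) is the derivative of [f] along the input that cell i receives from the
    j-th basis vector. *)
Lemma jac_netmx : smooth f -> jac N f = netmx N (lcoef f).
Proof.
move=> /(_ 1%N)[/(_ 0) df _].
have in0 i : cell_input N (0 : 'rV[R]_3) 0 i = 0.
  by rewrite -[X in cell_input N X](scale0r 0) cell_inputZ scale0r.
have dfi i : differentiable (f \o (fun y : 'rV[R]_3 => cell_input N y 0 i)) 0.
  apply: differentiable_comp; first exact: differentiable_cell_input.
  by rewrite in0.
have dg : differentiable (fun x : 'rV[R]_3 => coupled N f x 0) 0.
  apply: differentiable_rV => i.
  have -> // : (fun y : 'rV[R]_3 => coupled N f y 0 0 i) =
               f \o (fun y => cell_input N y 0 i).
  by apply: funext => y; rewrite mxE.
apply/matrixP => i j; rewrite mxE.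
have -> : jacobian (fun x : 'rV[R]_3 => coupled N f x 0) 0 j i =
    ('D_(delta_mx 0 j) (fun x : 'rV[R]_3 => coupled N f x 0) 0) 0 i.
  by rewrite deriveEjacobian // -rowE [RHS]mxE.
rewrite derive_mx; last exact: (diff_derivable dg).
rewrite mxE.
(* The difference quotients agree, because [cell_input] is homogeneous and vanishes at 0. *)
have -> : 'D_(delta_mx 0 j) (fun x : 'rV[R]_3 => coupled N f x 0 0 i) 0 =
          'D_(cell_input N (delta_mx 0 j) 0 i) f 0.
  rewrite /derive; set u := (fun _ : R => _); set w := (fun _ : R => _).
  suff -> : u = w by []; apply: funext => h; rewrite /u /w.
  by rewrite /= !mxE !addr0 cell_inputZ in0.
rewrite deriveE // cell_input_coords linearD linear_sum linearZ /=.
have lE l : 'd f 0 (delta_mx 0 (lshift 1 l)) = lcoef f l.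
  by rewrite -deriveE.
rewrite lE !mxE eqxx /= scaler_nat; congr (_ + _).
by apply: eq_bigr => l _; rewrite linearZ /= lE !mxE eqxx /= scaler_nat.
Qed.

End Jacobian.

(** * Generic conditions on the linear coefficients *)

Section Genericity.
Variables (R : realType) (k : nat).
Implicit Types (f : 'rV[R]_(1 + k + 1) -> R) (p : mpoly (1 + k) R).

Lemma mpartial1 n (g : 'rV[R]_n -> R) (j : 'I_n) :
  mpartial (mnm1 j) g = partial j g.
Proof.
rewrite /mpartial.
have foldE s : uniq s ->
    foldr (fun i h => iter (mnm1 j i) (@partial R n i) h) g s =
    if j \in s then partial j g else g.
  elim: s => //= i s IHs /andP[i_s /IHs ->]; rewrite mnm1E inE.
  by case: eqVneq => [->|]; rewrite //= (negPf i_s).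
by rewrite foldE ?enum_uniq // mem_enum.
Qed.

(** A single inequality on first derivatives suffices; the point [c] only certifies that the
    polynomial is nonzero. *)
Lemma generically_mpoly p (c : 'I_(1 + k) -> R)
    (P : ('rV[R]_(1 + k + 1) -> R) -> Prop) :
  meval c p != 0 ->
  (forall f, smooth f -> meval (lcoef f) p != 0 -> P f) -> generically P.
Proof.
move=> pc0 pP.
have p0 : p != 0 by apply: contraNneq pc0 => ->; rewrite meval0.
(* The unit multi-indices of f_0, ..., f_k; [lshift] leaves out the derivative in the parameter. *)
pose ix := [tuple mnm1 (lshift 1 j) | j < 1 + k].
have ix_pos : all (fun a : multinom _ => 0 < mdeg a)%N ix.
  by apply/allP => _ /mapP[j _ ->]; rewrite mdeg1.
have ix_uniq : uniq ix.
  rewrite map_inj_uniq ?enum_uniq // => i j /(congr1 (fun a : multinom _ => a (lshift 1 i))).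
  by rewrite !mnm1E eqxx (inj_eq (@lshift_inj _ _)); case: eqVneq.
exists [:: Inequality ix_pos ix_uniq p0] => f sf /andP[+ _].
rewrite /satisfies /= => pf; apply: pP => //; apply: contraNneq pf => <-.
by apply/eqP/meval_eq => // i; rewrite tnth_mktuple mpartial1.
Qed.

Lemma continuous_meval p :
  continuous (fun c : 'rV[R]_(1 + k) => meval (c 0) p).
Proof.
rewrite (_ : (fun c => _) = (fun c : 'rV[R]_(1 + k) =>
  \sum_(m <- msupp p) mcoeff m p * \prod_i c 0 i ^+ m i)); last first.
  by apply/funext => c; rewrite mevalE.
apply: (@continuous_big R _ +%R 0 predT (@add_continuous R) _ (msupp p)
  (fun m (c : 'rV[R]_(1 + k)) => mcoeff m p * \prod_i c 0 i ^+ m i)) => m _ c.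
apply: continuousM; first exact: cst_continuous.
apply: (@continuous_big R _ *%R 1 predT (@mul_continuous R) _ _
  (fun i (c : 'rV[R]_(1 + k)) => c 0 i ^+ m i)) => i _ {}c.
have h : {for c, continuous (fun c : 'rV[R]_(1 + k) => c 0 i)}
  by exact: coord_continuous.
exact: (continuous_comp h (@exprn_continuous R (m i) _)).
Qed.

Lemma generically_on_open_pos p (c : 'rV[R]_(1 + k))
    (P : ('rV[R]_(1 + k + 1) -> R) -> Prop) :
  0 < meval (c 0) p ->
  (forall f, smooth f -> 0 < meval (lcoef f) p -> P f) -> generically_on_open P.
Proof.
move=> pc pP; exists [set c : 'rV[R]_(1 + k) | 0 < meval (c 0) p]%classic.
split; first exact: (open_comp (fun x _ => @continuous_meval p x) (@open_gt R 0)).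
  by exists c.
(* The exceptional points lie outside the open set: no inequality is needed. *)
exists [::] => f sf _ /= pf; apply: pP => //; apply: lt_le_trans pf _.
by rewrite le_eqVlt; apply/orP; left; apply/eqP/meval_eq => // j; rewrite mxE.
Qed.

End Genericity.

(** * Discriminant and gap as polynomials in the coefficients *)

Section Networks.
Variable k : nat.
Implicit Types (S : comNzRingType) (N : network k).

(** Each cell receives exactly one edge of each type, so every coefficient occurs once in each
    row. *)
Lemma netmx_row S N (c : 'I_(1 + k) -> S) i :
  netmx N c i c1 + netmx N c i c2 + netmx N c i c3 = \sum_l c l.
Proof.
rewrite -(big_cells (netmx N c i)).
under eq_bigr do rewrite mxE.
rewrite big_split exchange_big /= big_split_ord big_ord1.
have pick (x : S) (j : 'I_3) : \sum_(j' < 3) x *+ (j == j') = x.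
  by rewrite (bigD1 j) //= eqxx big1 ?addr0 // => j' /negPf; rewrite eq_sym => ->.
rewrite pick; congr (_ + _).
by apply: eq_bigr => l _; rewrite pick.
Qed.

Lemma netmx_map S S' (h : {rmorphism S -> S'}) N (c : 'I_(1 + k) -> S) :
  map_mx h (netmx N c) = netmx N (h \o c).
Proof.
apply/matrixP => i j; rewrite !mxE rmorphD rmorphMn rmorph_sum.
by congr (_ + _); apply: eq_bigr => l _; rewrite rmorphMn.
Qed.

Definition net_disc S N (c : 'I_(1 + k) -> S) := disc (netmx N c) (\sum_l c l).
Definition net_gap S N (c : 'I_(1 + k) -> S) := gap (netmx N c) (\sum_l c l).

Lemma net_disc_map S S' (h : {rmorphism S -> S'}) N (c : 'I_(1 + k) -> S) :
  h (net_disc N c) = net_disc N (h \o c).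
Proof.
rewrite /net_disc /disc -netmx_map minors_map trace_map_mx.
by rewrite !(rmorphB, rmorphXn, rmorphMn, rmorphM, rmorph_sum).
Qed.

Lemma net_gap_map S S' (h : {rmorphism S -> S'}) N (c : 'I_(1 + k) -> S) :
  h (net_gap N c) = net_gap N (h \o c).
Proof.
rewrite /net_gap !gapE -netmx_map minors_map trace_map_mx.
by rewrite !(rmorphB, rmorphD, rmorphXn, rmorphMn, rmorphM, rmorph_sum).
Qed.

Variable R : realType.

(* Evaluating at these indeterminates turns [net_disc] and [net_gap] into
   polynomials in the linear coefficients of f. *)
Definition coefX (l : 'I_(1 + k)) : mpoly (1 + k) R := mpolyX R (mnm1 l).

Lemma meval_coefX (c : 'I_(1 + k) -> R) : meval c \o coefX =1 c.
Proof. by move=> l; rewrite /= mevalXU. Qed.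

Lemma meval_net_disc N (c : 'I_(1 + k) -> R) :
  meval c (net_disc N coefX) = net_disc N c.
Proof. by rewrite net_disc_map; congr net_disc; apply: funext; exact: meval_coefX. Qed.

Lemma meval_net_gap N (c : 'I_(1 + k) -> R) :
  meval c (net_gap N coefX) = net_gap N c.
Proof. by rewrite net_gap_map; congr net_gap; apply: funext; exact: meval_coefX. Qed.

(** The inequality is that discriminant times gap is nonzero; semidefiniteness then makes the
    discriminant positive. *)
Lemma generically_three_real N (c0 : 'I_(1 + k) -> R) :
  (forall c : 'I_(1 + k) -> R, 0 <= net_disc N c) ->
  0 < net_disc N c0 -> 0 < net_gap N c0 ->
  generically (fun f : 'rV[R]_(1 + k + 1) -> R => three_simple_real (jac N f)).
Proof.
move=> d_ge0 d0 g0.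
apply: (@generically_mpoly _ _ (net_disc N coefX * net_gap N coefX) c0).
  by rewrite mevalM meval_net_disc meval_net_gap mulf_neq0 ?gt_eqF.
move=> f sf; rewrite mevalM meval_net_disc meval_net_gap mulf_eq0 negb_or.
move=> /andP[d g]; rewrite jac_netmx //.
apply: (three_simple_real_disc (netmx_row N (lcoef f))) g.
by rewrite lt_def d d_ge0.
Qed.

Lemma open_three_real N (c0 : 'I_(1 + k) -> R) :
  0 < net_disc N c0 -> 0 < net_gap N c0 ->
  generically_on_open
    (fun f : 'rV[R]_(1 + k + 1) -> R => three_simple_real (jac N f)).
Proof.
(* Squaring the gap makes positivity of the product mean: positive discriminant and nonzero gap. *)
move=> d0 g0; apply: (@generically_on_open_pos _ _
  (net_disc N coefX * net_gap N coefX ^+ 2) (\row_l c0 l)).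
  rewrite (@meval_eq _ _ _ c0) => [|l]; last by rewrite mxE.
  by rewrite rmorphM rmorphXn /= meval_net_disc meval_net_gap mulr_gt0 ?exprn_gt0.
move=> f sf; rewrite rmorphM rmorphXn /= meval_net_disc meval_net_gap => dg.
have g : net_gap N (lcoef f) != 0.
  by apply: contraTneq dg => ->; rewrite expr0n mulr0 ltxx.
rewrite jac_netmx //; apply: (three_simple_real_disc (netmx_row _ _) _ g).
by rewrite pmulr_lgt0 ?exprn_even_gt0 in dg.
Qed.

Lemma generically_nonreal N (c0 : 'I_(1 + k) -> R) :
  (forall c : 'I_(1 + k) -> R, net_disc N c <= 0) -> net_disc N c0 < 0 ->
  generically (fun f : 'rV[R]_(1 + k + 1) -> R =>
    three_simple_nonreal (jac N f) (valency f)).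
Proof.
move=> d_le0 d0; apply: (@generically_mpoly _ _ (net_disc N coefX) c0).
  by rewrite meval_net_disc lt_eqF.
move=> f sf; rewrite meval_net_disc jac_netmx // => d.
apply: (three_simple_nonreal_disc (netmx_row N (lcoef f))).
by rewrite lt_neqAle d d_le0.
Qed.

End Networks.

(** * Networks with one or two inputs *)

Lemma netmx1 (S : comNzRingType) (X : edge_type) (c : 'I_(1 + 1) -> S) i j :
  netmx (net1 X) c i j =
  c (lshift 1 ord0) *+ (i == j) + c (rshift 1 ord0) *+ (tnth X i == j).
Proof. by rewrite mxE big_ord1 /source (tnth_nth X). Qed.

Lemma netmx2 (S : comNzRingType) (X Y : edge_type) (c : 'I_(1 + 2) -> S) i j :
  netmx (net2 X Y) c i j =
  c (lshift 2 ord0) *+ (i == j) +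
  (c (rshift 1 ord0) *+ (tnth X i == j) + c (rshift 1 ord_max) *+ (tnth Y i == j)).
Proof.
rewrite mxE 2!big_ord_recl big_ord0 addr0 /source !(tnth_nth X) /=.
by congr (_ + (_ + c (rshift _ _) *+ _)); apply: val_inj.
Qed.

Lemma sum_net1 (S : comNzRingType) (c : 'I_(1 + 1) -> S) :
  \sum_l c l = c (lshift 1 ord0) + c (rshift 1 ord0).
Proof. by rewrite big_split_ord !big_ord1. Qed.

Lemma sum_net2 (S : comNzRingType) (c : 'I_(1 + 2) -> S) :
  \sum_l c l = c (lshift 2 ord0) + (c (rshift 1 ord0) + c (rshift 1 ord_max)).
Proof.
rewrite big_split_ord big_ord1 big_ord_recl big_ord1 /=.
by congr (_ + (_ + c (rshift _ _))); apply: val_inj.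
Qed.

Lemma cells_ind (P : 'I_3 -> Prop) : P c1 -> P c2 -> P c3 -> forall i, P i.
Proof.
move=> P1 P2 P3 [[|[|[|//]]] i]; [move: P1|move: P2|move: P3];
  by congr P; apply: val_inj.
Qed.

Lemma cells_eqE : (((c1 == c1) = true) * ((c1 == c2) = false) * ((c1 == c3) = false)
 * ((c2 == c1) = false) * ((c2 == c2) = true) * ((c2 == c3) = false)
 * ((c3 == c1) = false) * ((c3 == c2) = false) * ((c3 == c3) = true))%type.
Proof. by do !split. Qed.

(** * Networks with a double internal eigenvalue *)

Section DoubleEigenvalue.
Variables (R : realType) (k : nat) (N : network k).
Implicit Type c : 'I_(1 + k) -> R.

(** The trace says that the two roots other than the valency sum to 2 f_0; a vanishing discriminant
    says that they coincide. *)
Lemma net_internal_simple c :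
  \sum_l c l != c (lshift k ord0) ->
  \tr (netmx N c) = \sum_l c l + c (lshift k ord0) *+ 2 -> net_disc N c = 0 ->
  char_poly (netmx N c) = ('X - (\sum_l c l)%:P) *
    ('X - (c (lshift k ord0))%:P) * ('X - (c (lshift k ord0))%:P) /\
  eigen_mult (netmx N c) (\sum_l c l) 1 1.
Proof.
rewrite /net_disc /disc => vc trM d0.
have charM : char_poly (netmx N c) = ('X - (\sum_l c l)%:P) *
    ('X - (c (lshift k ord0))%:P) * ('X - (c (lshift k ord0))%:P).
  apply: (char_poly_const_rows (netmx_row N c)); first by rewrite trM; ring.
  by move: d0; rewrite trM; set m := minors _; lra.
by split; last exact: (simple_root charM vc vc).
Qed.

(* The internal eigenvalue f_0 is defective as soon as some 2 x 2 minor of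
   J - f_0 Id is nonzero; rows 1, 3 and columns 1, 2 suit all networks of (iii). *)
Definition net_minor (S : comNzRingType) (c : 'I_(1 + k) -> S) : S :=
  let A := netmx N c - (c (lshift k ord0))%:M in
  A c1 c1 * A c3 c2 - A c1 c2 * A c3 c1.

Lemma net_minor_map (S S' : comNzRingType) (h : {rmorphism S -> S'}) (c : 'I_(1 + k) -> S) :
  h (net_minor c) = net_minor (h \o c).
Proof.
by rewrite /net_minor -netmx_map !mxE !(rmorphB, rmorphM, rmorphMn).
Qed.

Lemma net_minorE (S : comNzRingType) (c : 'I_(1 + k) -> S) :
  net_minor c = (netmx N c c1 c1 - c (lshift k ord0)) * netmx N c c3 c2 -
                netmx N c c1 c2 * netmx N c c3 c1.
Proof.
have subE i j : (netmx N c - (c (lshift k ord0))%:M) i j =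
    netmx N c i j - c (lshift k ord0) *+ (i == j) by rewrite !mxE.
by rewrite /net_minor !subE /= mulr1n !mulr0n !subr0.
Qed.

Lemma generically_nz c0 (P : ('rV[R]_(1 + k + 1) -> R) -> Prop) :
  \sum_l c0 l != c0 (lshift k ord0) ->
  (forall f, smooth f -> valency f != lcoef f ord0 -> P f) -> generically P.
Proof.
move=> nz0 nzP; apply: (@generically_mpoly _ _
  (\sum_l coefX R l - coefX R (lshift k ord0)) c0).
  rewrite rmorphB rmorph_sum /= mevalXU subr_eq0.
  by under eq_bigr do rewrite mevalXU.
move=> f sf; rewrite rmorphB rmorph_sum /= mevalXU subr_eq0.
by under eq_bigr do rewrite mevalXU; exact: nzP.
Qed.

(** In the product below, the first factor separates the valency from f_0 and the second forces J -
    f_0 Id to have rank at least 2. *)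
Lemma generically_defective c0 :
  (forall c, \tr (netmx N c) = \sum_l c l + c (lshift k ord0) *+ 2) ->
  (forall c, net_disc N c = 0) ->
  \sum_l c0 l != c0 (lshift k ord0) -> net_minor c0 != 0 ->
  generically (fun f : 'rV[R]_(1 + k + 1) -> R =>
    let J := jac N f in
    eigen_mult J (valency f) 1 1 /\ eigen_mult J (lcoef f ord0) 2 1).
Proof.
move=> trM d0 nz0 min0; apply: (@generically_mpoly _ _
  ((\sum_l coefX R l - coefX R (lshift k ord0)) * net_minor (coefX R)) c0).
  rewrite rmorphM rmorphB rmorph_sum /= net_minor_map mevalXU.
  rewrite (_ : _ \o _ = c0); last by apply: funext; exact: meval_coefX.
  under eq_bigr do rewrite mevalXU.
  by rewrite mulf_neq0 // subr_eq0.
move=> f sf; rewrite rmorphM rmorphB rmorph_sum /= net_minor_map mevalXU.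
rewrite (_ : _ \o _ = lcoef f); last by apply: funext; exact: meval_coefX.
under eq_bigr do rewrite mevalXU.
rewrite mulf_eq0 negb_or subr_eq0 => /andP[nz min].
rewrite jac_netmx //.
have [charM ev] := net_internal_simple nz (trM _) (d0 _).
split; first exact: ev.
apply: (defective_double_root charM nz).
by apply: (@rank_gt1 _ _ _ _ c1 c3 c1 c2); rewrite -subr_eq0.
Qed.

(** When sources do not depend on the receiving cell, all rows of J - f_0 Id equal the same vector
    [w]. Its entries sum to the valency minus f_0, so [w] is nonzero and the rank is 1. *)
Lemma generically_semisimple c0 :
  (forall i l, source N i l = source N c1 l) ->
  \sum_l c0 l != c0 (lshift k ord0) ->
  generically (fun f : 'rV[R]_(1 + k + 1) -> R =>
    let J := jac N f in
    eigen_mult J (valency f) 1 1 /\ eigen_mult J (lcoef f ord0) 2 2).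
Proof.
move=> srcN nz0; apply: (generically_nz nz0) => f sf; rewrite jac_netmx //.
rewrite /valency; set c := lcoef f => nz.
pose w j := \sum_(l < k) c (rshift 1 l) *+ (source N c1 l == j).
have ME i j : netmx N c i j = c (lshift k ord0) *+ (i == j) + w j.
  by rewrite mxE; congr (_ + _); apply: eq_bigr => l _; rewrite srcN.
have sumw := netmx_row N c c1; rewrite !ME /= in sumw.
have trM : \tr (netmx N c) = \sum_l c l + c (lshift k ord0) *+ 2.
  by rewrite mxtrace_cells !ME -sumw !(mulr1n, mulr0n); ring.
have disc0 : net_disc N c = 0.
  by rewrite /net_disc /disc trM /minors !ME -sumw !(mulr1n, mulr0n); ring.
have [charM ev] := net_internal_simple nz trM disc0.
split; first exact: ev.
apply: (semisimple_double_root charM nz).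
have [j wj] : exists j, w j != 0.
  case: (eqVneq (w c1) 0) => [w1|]; last by exists c1.
  case: (eqVneq (w c2) 0) => [w2|]; last by exists c2.
  exists c3; apply: contraNneq nz => w3.
  by rewrite -sumw w1 w2 w3 !addr0.
apply: (@rank_cell_const _ _ _ c1 j (fun=> 1) w) => [x y|].
  by rewrite mxE ME !mxE mul1r addrAC subrr add0r.
by rewrite mxE ME !mxE addrAC subrr add0r.
Qed.

End DoubleEigenvalue.

(** * Verification network by network *)

Lemma all_netP (P : network 2 -> Prop) (s : seq (network 2)) :
  foldr (fun N Q => P N /\ Q) True s -> forall N, N \in s -> P N.
Proof.
by elim: s => //= N s IHs [PN /IHs Ps] N'; rewrite inE => /orP[/eqP ->|/Ps].
Qed.

Ltac net_simpl :=
  rewrite /net_disc /net_gap ?gapE /disc /minors ?mxtrace_cells ?net_minorE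
    ?sum_net1 ?sum_net2 ?netmx1 ?netmx2 ?(tnth_nth c1) /= ?cells_eqE
    ?(mulr0n, mulr1n, addr0, add0r).

Ltac net_ring :=
  let c := fresh "c" in move=> c; net_simpl;
  move: (c (lshift _ _)) (c (rshift _ ord0)) (c (rshift _ ord_max)) => *; ring.

Ltac net_lra := net_simpl; lra.

(* Up to sign, the discriminants in (iv) and (vi) are nonnegative combinations
   of these squares. *)
Ltac net_sign :=
  let c := fresh "c" in move=> c; net_simpl;
  move: (c (lshift _ _)) (c (rshift _ ord0)) (c (rshift _ ord_max)) => x y z;
  have := sqr_ge0 y; have := sqr_ge0 z; have := sqr_ge0 (y - z);
  have := sqr_ge0 (y + z); have := sqr_ge0 (y *+ 2 - z); lra.

(** Discriminant and gap are unchanged when f_0 Id is added to the matrix and f_0 to the valency,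
    hence the choice f_0 = 0. At (f_1, f_2) = (2, 1) none of the squares used by [net_sign]
    vanishes. *)
Definition disc_witness (R : realType) (N : network 2) : Prop :=
  [/\ forall c : 'I_(1 + 2) -> R, 0 <= net_disc N c,
      0 < net_disc N (fun l => nth (0 : R) [:: 0; 2; 1] l) &
      0 < net_gap N (fun l => nth (0 : R) [:: 0; 2; 1] l)].

Lemma listIII_disc (R : realType) (N : network 2) :
  N \in listIII -> disc_witness R N.
Proof.
move: N; apply: all_netP.
by do !(split; first by split; [net_sign | net_lra | net_lra]).
Qed.

Lemma listV_disc (R : realType) (N : network 2) :
  N \in listV -> disc_witness R N.
Proof.
move: N; apply: all_netP.
by do !(split; first by split; [net_sign | net_lra | net_lra]).
Qed.

Lemma listI_disc (R : realType) (N : network 2) :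
  N \in [:: net2 E6 B1; net2 B1 F2; net2 B1 B3] -> disc_witness R N.
Proof.
move: N; apply: all_netP.
by do !(split; first by split; [net_sign | net_lra | net_lra]).
Qed.

Lemma listII_disc (R : realType) (N : network 2) :
  N \in listII ->
  exists c : 'I_(1 + 2) -> R, 0 < net_disc N c /\ 0 < net_gap N c.
Proof.
move: N; apply: all_netP; do !split.
all: try solve [exists (fun l => nth (0 : R) [:: 0; 2; 1] l); split; net_lra].
(* At (2, 1) the discriminant is negative for [D1 & F6], [D1 & A1], [D1 & D5], [D1 & B2] and
   [F1 & A2]; a ratio f_1 / f_2 = -5 makes it positive. *)
all: by exists (fun l => nth (0 : R) [:: 0; -5; 1] l); split; net_lra.
Qed.

(** Opposite coefficients on [1 1 2] and [3 1 3] give the quotient the roots 1 and -1. The type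
    [1 1 1] adds equal rows and so moves only the valency, here to -2, away from both. *)
Lemma netM6_disc (R : realType) :
  let c : 'I_(1 + 6) -> R := fun l => nth 0 [:: 0; -2; 0; 0; -1; 0; 1] l in
  0 < net_disc netM6 c /\ 0 < net_gap netM6 c.
Proof.
rewrite /= /net_disc /net_gap gapE /disc /minors mxtrace_cells !mxE.
rewrite !big_ord_recl !big_ord0.
rewrite /source !(tnth_nth C1) /=.
rewrite !(mulr0n, mulr1n, addr0, add0r).
split; lra.
Qed.

(** The discriminants are -3 f_2^2 for [C1 & A2] and -3 (f_1 - f_2)^2 for [A2 & A1]. *)
Lemma nonreal_disc (R : realType) (N : network 2) :
  N \in [:: net2 C1 A2; net2 A2 A1] ->
  (forall c : 'I_(1 + 2) -> R, net_disc N c <= 0) /\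
  net_disc N (fun l => nth (0 : R) [:: 0; 2; 1] l) < 0.
Proof.
move: N; apply: all_netP; do !split; by [net_sign | net_lra].
Qed.

Lemma netA_disc (R : realType) :
  (forall c : 'I_(1 + 1) -> R, net_disc netA c <= 0) /\
  net_disc netA (fun l : 'I_(1 + 1) => nth (0 : R) [:: 0; 1] l) < 0.
Proof.
split; last by net_lra.
by move=> c; net_simpl; have := sqr_ge0 (c (rshift 1 ord0)); nra.
Qed.

(** Cells 1 and 3 receive only from themselves, and cell 2 only from these two, so the eigenvalues
    are v, v and f_0. *)
Lemma E6E4_invariants (R : realType) (c : 'I_(1 + 2) -> R) :
  let M := netmx (net2 E6 E4) c in
  let x := c (lshift 2 ord0) in let v := \sum_l c l in
  \tr M = v + v + x /\ minors M = v * v + v * x + v * x.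
Proof.
rewrite /= sum_net2; split; net_simpl;
  by move: (c (lshift _ _)) (c (rshift _ ord0)) (c (rshift _ ord_max)) => *; ring.
Qed.

(** Only row 2 of J - v Id is nonzero; its diagonal entry is f_0 - v. *)
Lemma E6E4_rank (R : realType) (c : 'I_(1 + 2) -> R) :
  \sum_l c l != c (lshift 2 ord0) ->
  \rank (netmx (net2 E6 E4) c - (\sum_l c l)%:M)%R = 1%N.
Proof.
rewrite sum_net2.
set x := c (lshift 2 ord0); set y := c (rshift 1 ord0).
set z := c (rshift 1 ord_max) => vx.
have ME i j : (netmx (net2 E6 E4) c - (x + (y + z))%:M) i j =
    (i == c2)%:R * (y *+ (j == c1) - (y + z) *+ (j == c2) + z *+ (j == c3)).
  rewrite mxE netmx2 !mxE !(tnth_nth c1) /= -/x -/y -/z.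
  elim/cells_ind: i; elim/cells_ind: j;
    rewrite /= ?cells_eqE !(mulr0n, mulr1n); ring.
apply: (rank_cell_const (i := c2) (j := c2) ME); rewrite ME.
rewrite !cells_eqE !(mulr0n, mulr1n) mul1r add0r addr0 oppr_eq0.
by apply: contraNneq vx => ->; rewrite addr0.
Qed.

Lemma generically_E6E4 (R : realType) :
  generically (fun f : 'rV[R]_(1 + 2 + 1) -> R =>
    let J := jac (net2 E6 E4) f in
    eigen_mult J (valency f) 2 2 /\ eigen_mult J (lcoef f ord0) 1 1).
Proof.
pose c0 l : R := nth 0 [:: 0; 2; 1] (l : 'I_(1 + 2)).
have nz0 : \sum_l c0 l != c0 (lshift 2 ord0).
  by rewrite sum_net2 /c0 /=; apply/eqP; lra.
apply: (generically_nz nz0) => f sf; rewrite jac_netmx // => nz.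
have [trM minM] := E6E4_invariants (lcoef f).
have := char_poly_const_rows (netmx_row _ _) trM minM.
(* The factor of f_0 goes first, so that the valency is the repeated root in [charM]. *)
rewrite mulrC mulrA => charM.
have xv : lcoef f (lshift 2 ord0) != \sum_l lcoef f l by rewrite eq_sym.
split; last exact: (simple_root charM xv xv).
exact: (semisimple_double_root charM xv (E6E4_rank nz)).
Qed.

Lemma generically_listIV (R : realType) (N : network 2) :
  N \in [:: net2 C1 D1; net2 C1 D4; net2 C1 D6; net2 D1 D4] ->
  generically (fun f : 'rV[R]_(1 + 2 + 1) -> R =>
    let J := jac N f in
    eigen_mult J (valency f) 1 1 /\ eigen_mult J (lcoef f ord0) 2 1).
Proof.
move=> NIV.
have [trN dN [nz min]] : [/\
    forall c : 'I_(1 + 2) -> R,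
      \tr (netmx N c) = \sum_l c l + c (lshift 2 ord0) *+ 2,
    forall c : 'I_(1 + 2) -> R, net_disc N c = 0 &
    let c : 'I_(1 + 2) -> R := fun l => nth 0 [:: 0; 2; 1] l in
    \sum_l c l <> c (lshift 2 ord0) /\ net_minor N c <> 0].
  move: N NIV; apply: all_netP.
  by do !(split; first by split;
    [net_ring | net_ring | split; net_simpl => h; lra]).
by apply: generically_defective trN dN _ _; apply/eqP; [exact: nz | exact: min].
Qed.

Lemma generically_netD (R : realType) :
  generically (fun f : 'rV[R]_(1 + 1 + 1) -> R =>
    let J := jac netD f in
    eigen_mult J (valency f) 1 1 /\ eigen_mult J (lcoef f ord0) 2 1).
Proof.
apply: (@generically_defective _ _ _ (fun l => nth 0 [:: 0; 1] l)).
- by move=> c; net_simpl; ring.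
- by move=> c; net_simpl; ring.
- by net_simpl; apply/eqP => h; lra.
by net_simpl; apply/eqP => h; lra.
Qed.

Lemma generically_netF (R : realType) :
  generically (fun f : 'rV[R]_(1 + 1 + 1) -> R => three_simple_real (jac netF f)).
Proof.
apply: (@generically_three_real _ _ _ (fun l => nth 0 [:: 0; 1] l)).
- by move=> c; net_simpl; have := sqr_ge0 (c (rshift 1 ord0)); lra.
- by net_lra.
by net_lra.
Qed.

Theorem theorem5p2 (R : realType) :
  [/\ (* (i) *)
      generically (fun f : 'rV[R]_(1 + 2 + 1) -> R =>
        let J := jac (net2 E6 E4) f in
        eigen_mult J (valency f) 2 2 /\ eigen_mult J (lcoef f ord0) 1 1),
      (* (ii) *)
      generically (fun f : 'rV[R]_(1 + 1 + 1) -> R =>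
        let J := jac netC f in
        eigen_mult J (valency f) 1 1 /\ eigen_mult J (lcoef f ord0) 2 2) /\
      generically (fun f : 'rV[R]_(1 + 2 + 1) -> R =>
        let J := jac (net2 C1 C2) f in
        eigen_mult J (valency f) 1 1 /\ eigen_mult J (lcoef f ord0) 2 2),
      (* (iii) *)
      generically (fun f : 'rV[R]_(1 + 1 + 1) -> R =>
        let J := jac netD f in
        eigen_mult J (valency f) 1 1 /\ eigen_mult J (lcoef f ord0) 2 1) /\
      (forall N : network 2,
        N \in [:: net2 C1 D1; net2 C1 D4; net2 C1 D6; net2 D1 D4] ->
        generically (fun f : 'rV[R]_(1 + 2 + 1) -> R =>
          let J := jac N f in
          eigen_mult J (valency f) 1 1 /\ eigen_mult J (lcoef f ord0) 2 1)),
      (* (iv) *)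
      generically (fun f : 'rV[R]_(1 + 1 + 1) -> R =>
        three_simple_real (jac netF f)) /\
      (forall N : network 2,
        N \in listIII ++ listV ++ [:: net2 E6 B1; net2 B1 F2; net2 B1 B3] ->
        generically (fun f : 'rV[R]_(1 + 2 + 1) -> R =>
          three_simple_real (jac N f))) &
      (* (v) *)
      ((forall N : network 2, N \in listII ->
        generically_on_open (fun f : 'rV[R]_(1 + 2 + 1) -> R =>
          three_simple_real (jac N f))) /\
       generically_on_open (fun f : 'rV[R]_(1 + 6 + 1) -> R =>
         three_simple_real (jac netM6 f))) /\
      (* (vi) *)
      (generically (fun f : 'rV[R]_(1 + 1 + 1) -> R =>
         three_simple_nonreal (jac netA f) (valency f)) /\
       (forall N : network 2, N \in [:: net2 C1 A2; net2 A2 A1] ->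
         generically (fun f : 'rV[R]_(1 + 2 + 1) -> R =>
           three_simple_nonreal (jac N f) (valency f))))].
Proof.
split; first exact: generically_E6E4.
- split; [apply: (generically_semisimple (c0 := fun l => nth 0 [:: 0; 1] l))
         |apply: (generically_semisimple (c0 := fun l => nth 0 [:: 0; 2; 1] l))].
  + by move=> i l; rewrite /source !(tnth_nth C1) /= ord1 !(tnth_nth c1);
       elim/cells_ind: i.
  + by net_simpl; apply/eqP => h; lra.
  + move=> i l; rewrite /source !(tnth_nth C1) /= !(tnth_nth c1).
    by elim/cells_ind: i => //; case: l => [[|[|]]].
  + by net_simpl; apply/eqP => h; lra.
- by split; [exact: generically_netD | exact: generically_listIV].
- split; first exact: generically_netF.
  move=> N; rewrite !mem_cat => NL.
  have [d0 d1 g1] : disc_witness R N.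
    case/or3P: NL; [exact: listIII_disc | exact: listV_disc | exact: listI_disc].
  exact: generically_three_real d0 d1 g1.
split; last first.
  split; first by have [d_le0 d_lt0] := netA_disc R; exact: generically_nonreal d_le0 d_lt0.
  move=> N /(nonreal_disc R)[d_le0 d_lt0].
  exact: generically_nonreal d_le0 d_lt0.
split=> [N /(listII_disc R)[c [d g]]|]; first exact: open_three_real d g.
by have [d g] := netM6_disc R; exact: open_three_real d g.
Qed.
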